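(* Let $(X_i)_{i\ge 1}$ be a sequence of independent identically distributed random variables, each having the exponential distribution with mean $1$. For $i\in\mathbb{N}^+$ let $\overline{X}_i:=(X_1+X_2+\cdots+X_i)/i$, and let $Z_\infty:=\sup\{\overline{X}_i : i\in\mathbb{N}^+\}$ (which is finite with probability $1$). Let $F_\infty$ denote the distribution function of $Z_\infty$. Then: (a) For all $x>0$, $$F_\infty(x)=1-\sum_{k=1}^\infty \frac{k^{k-1}}{k!}\, x^{k-1}e^{-kx},$$ and $Z_\infty$ has a density which is continuous on $\mathbb{R}\setminus\{1\}$, positive on $(1,\infty)$, and zero on $(-\infty,1)$. (b) The restriction of $F_\infty$ to $(1,\infty)$ is one-to-one and onto $(0,1)$, with inverse $$F_\infty^{-1}(u)=\frac{-\log(1-u)}{u}\quad\text{for all } u\in(0,1).$$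
   Context: $\mathbb{N}^+=\{1,2,3,\ldots\}$. The distribution function of a random variable $Z$ is $x\mapsto \Pr[Z\le x]$. Here $\log$ is the natural logarithm. *)

(* Defs.v *)
From HB Require Import structures.
From mathcomp Require Export all_boot all_order all_algebra.
From mathcomp Require Export finmap.
From mathcomp Require Export all_classical all_reals all_analysis measurable_realfun.
Export Order.TTheory GRing.Theory Num.Theory.
Export numFieldNormedType.Exports.
Set Implicit Arguments.
Unset Strict Implicit.
Unset Printing Implicit Defensive.
Local Open Scope classical_set_scope.
Local Open Scope ring_scope.

Definition mutually_independent d (T : measurableType d) (R : realType)
    (P : probability T R) (X : nat -> {RV P >-> R}) : Prop :=
  forall (J : {fset nat}) (A : nat -> set R),
    (forall j, measurable (A j)) ->
    P (\bigcap_(j in [set` J]) (X j @^-1` A j)) =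
      (\prod_(j <- J) P (X j @^-1` A j))%E.

(* The exponential distribution with mean m has rate 1 / m. *)
Definition exponential_with_mean d (T : measurableType d) (R : realType)
    (P : probability T R) (m : R) (X : {RV P >-> R}) : Prop :=
  forall A : set R, measurable A -> distribution P X A = exponential_prob m^-1 A.

(* Sequences are indexed from 0: X n stands for the (n+1)-st variable, so
   running_mean X n is the mean of the first n+1 variables. *)
Definition running_mean d (T : measurableType d) (R : realType)
    (X : nat -> {mfun T >-> R}) (n : nat) (w : T) : R :=
  (\sum_(j < n.+1) X j w) / n.+1%:R.

(* The supremum is taken in the extended reals, so it is meaningful also on the
   null event where the running means are unbounded. *)
Definition sup_running_mean d (T : measurableType d) (R : realType)
    (X : nat -> {mfun T >-> R}) (w : T) : \bar R :=
  ereal_sup (range (fun n => (running_mean X n w)%:E)).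

Lemma measurable_running_mean d (T : measurableType d) (R : realType)
    (X : nat -> {mfun T >-> R}) (n : nat) :
  measurable_fun [set: T] (running_mean X n).
Proof.
apply: measurable_funM => //; apply: measurable_sum => j; exact: measurable_funPT.
Qed.

Lemma measurable_sup_running_mean d (T : measurableType d) (R : realType)
    (X : nat -> {mfun T >-> R}) :
  measurable_fun [set: T] (sup_running_mean X).
Proof.
pose f n w := (running_mean X n w)%:E.
have -> : sup_running_mean X = (fun w => esups (f ^~ w) 0%N).
  apply/funext => w; congr ereal_sup; apply/seteqP.
  by split=> [_ [n _ <-]|_ [n _ <-]]; exists n.
apply: measurable_fun_esups => n; apply/measurable_EFinP.
exact: measurable_running_mean.
Qed.

HB.instance Definition _ d (T : measurableType d) (R : realType)
    (X : nat -> {mfun T >-> R}) :=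
  isMeasurableFun.Build _ _ T (\bar R) (sup_running_mean X)
    (measurable_sup_running_mean X).

(* [cdf] of the library only covers real-valued random variables. *)
Definition distribution_function d (T : measurableType d) (R : realType) (P : probability T R)
    (Z : {RV P >-> \bar R}) (x : R) : R :=
  fine (distribution P Z [set z | (z <= x%:E)%E]).

(* Taking B = setT gives that f integrates to 1, and B = [set -oo; +oo] that Z is
   almost surely finite. *)
Definition has_density d (T : measurableType d) (R : realType)
    (P : probability T R) (Z : {RV P >-> \bar R}) (f : R -> R) : Prop :=
  [/\ measurable_fun [set: R] f,
      forall x, 0 <= f x &
      forall B : set (\bar R), measurable B ->
        distribution P Z B =
          (\int[lebesgue_measure]_(x in EFin @^-1` B) (f x)%:E)%E].

(* Main.v *)
From HB Require Import structures.
Require Import Defs.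
From mathcomp Require Import ring lra.
Set Implicit Arguments.
Unset Strict Implicit.
Unset Printing Implicit Defensive.
Local Open Scope classical_set_scope.
Local Open Scope ring_scope.

(** Let S_i = X_1 + ... + X_i. Conditioning on X_1, the probability h_n(c) that
    S_i <= c + (i-1) x for 1 <= i <= n satisfies
    h_(n+1)(c) = \int_0^c e^(-y) h_n(c - y + x) dy, which is solved by
    h_n(c) = 1 - \sum_(k<n) c (c + k x)^(k-1) / k! e^(-(c + k x)). At c = x the
    event is that the first n means are at most x, whence the series for F.
    For x < 1 the recursion also gives h_n(c) <= rho^n e^(t c) with t > 0 and
    rho = e^(t x) / (1 + t) < 1, so F = 0 on ]-oo, 1[. The series shows that
    x (1 - F x) depends only on x e^(-x). For x = - log (1 - u) / u > 1 the number
    y = (1 - u) x < 1 satisfies y e^(-y) = x e^(-x), so x (1 - F x) = y, that is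
    F x = u. The density comes from differentiating this inverse. *)

(** * The deterministic recursion *)

(** [c (c + k x)^(k-1) / k!], the volume of the set of [0 <= s_1 <= ... <= s_k]
    with [s_i <= c + (i-1) x]; the case [k = 0] is the limit value [1]. *)
Definition abel (R : realType) (x : R) (k : nat) (c : R) : R :=
  if k is m.+1 then c * (c + k%:R * x) ^+ m / k`!%:R else 1.

(** The probability that [S_i <= c + (i-1) x] for [1 <= i <= n], see [law_levelE]. *)
Definition stay (R : realType) (x : R) (n : nat) (c : R) : R :=
  1 - \sum_(k < n) abel x k c * expR (- (c + k%:R * x)).

Section stay.
Context {R : realType}.
Implicit Types x c : R.

Lemma natr_factS k : [/\ (k.+1`!%:R : R) = k.+1%:R * k`!%:R,
  (k`!%:R : R) != 0 & (k.+1%:R : R) != 0].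
Proof. by split; rewrite ?factS ?natrM// pnatr_eq0// -lt0n fact_gt0. Qed.

(** The product rule leaves the factor [(c + k.+1 x) + k c = k.+1 (c + x)], which cancels one factor
    of the factorial, and [c + k.+1 x] is [(c + x) + k x]. *)
Lemma is_derive_abel x k c : is_derive c 1 (abel x k.+1) (abel x k (c + x)).
Proof.
have [E k0 S0] := natr_factS k.
case: k E k0 S0 => [|k] E k0 S0.
  rewrite (_ : abel x 1 = id); first exact: is_derive_id.
  by apply/funext => z; rewrite /abel expr0 mulr1 divr1.
have -> : abel x k.+2 =
    cst ((k.+2`!%:R)^-1) * (id * (id + cst (k.+2%:R * x)) ^+ k.+1).
  by apply/funext => z; rewrite /abel mulrC exprfctE.
rewrite E.
have [{}E k1 S1] := natr_factS k.
apply: is_derive_eq.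
rewrite /abel /GRing.scale/= exprfctE !fctE E.
have -> : c + x + k.+1%:R * x = c + k.+2%:R * x by rewrite -[k.+2]addn1 natrD; ring.
rewrite exprS -[k.+2]addn1 natrD; field.
by rewrite nat1r natr1 k1 S1 S0.
Qed.

(** Differential form of the recursion. Differentiating the exponentials returns the sum itself;
    differentiating [abel] shifts both [k] and [c], which turns it into the sum for [n] at
    [c + x]. *)
Lemma is_derive_stay x n c :
  is_derive c 1 (stay x n.+1) (stay x n (c + x) - stay x n.+1 c).
Proof.
have -> : stay x n.+1 =
    cst 1 - \sum_(k < n.+1) (abel x k * (expR \o - (id + cst (k%:R * x)))).
  by apply/funext => z; rewrite /stay !fctE fct_sumE.
apply: is_derive_eq.
  apply: is_deriveB; rewrite big_ord_recl.
  apply: is_deriveD.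
    by apply: is_deriveM; exact: is_derive_cst.
  apply: is_derive_sum => k.
  by apply: is_deriveM; exact: is_derive_abel.
rewrite /stay/= !fctE fct_sumE !big_ord_recl/= big_split/=.
rewrite [X in _ + (X + _)](_ : _ = - \sum_(k < n)
    abel x k.+1 c * expR (- (c + k.+1%:R * x))); last first.
  by rewrite -sumrN; apply: eq_bigr => k _; rewrite /GRing.scale/= addr0 mulrN1 mulrN.
rewrite [X in _ + (_ + X)](_ : _ = \sum_(k < n)
    abel x k (c + x) * expR (- (c + x + k%:R * x))); last first.
  apply: eq_bigr => k _; rewrite /GRing.scale/= mulrC !fctE; congr (_ * expR (- _)).
  by rewrite /bump/= -natr1; ring.
rewrite /GRing.scale/=.
rewrite (_ : _ c = expR (- (c + 0 * x))); last by rewrite !fctE mul1r.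
ring.
Qed.

Lemma stay_at0 x n : stay x n.+1 0 = 0.
Proof.
rewrite /stay big_ord_recl big1 ?addr0 => [|k _]; last by rewrite /abel/= !mul0r.
by rewrite /abel mul0r addr0 oppr0 expR0 mulr1 subrr.
Qed.

Lemma staySE x n : stay x n x = 1 - \sum_(1 <= k < n.+1)
  (k ^ k.-1)%N%:R / (k`!)%:R * x ^+ k.-1 * expR (- (k%:R * x)).
Proof.
rewrite /stay big_add1 big_mkord; congr (_ - _); apply: eq_bigr => -[k kn] _ /=.
have -> : x + k%:R * x = k.+1%:R * x by rewrite -natr1; ring.
congr (_ * _); case: k kn => [|k] _; first by rewrite expr0 exp1n divr1 mulr1.
have [E k1 S1] := natr_factS k; have [{}E2 k2 S2] := natr_factS k.+1.
(* With [j = k + 2] the claim is [x (j x)^k / (j-1)! = j^(j-1) / j! x^(j-1)]. *)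
rewrite /abel E2 E natrX.
have -> : x + k.+1%:R * x = k.+2%:R * x by rewrite -natr1 -[X in _ = X * _]natr1; ring.
rewrite exprMn exprS exprS.
field.
by rewrite k1 nat1r S1 -(natrD _ 2 k) S2.
Qed.

Lemma derivable_stay x n c : derivable (stay x n.+1) c 1.
Proof. by have [] := is_derive_stay x n c. Qed.

Lemma continuous_stay x n : continuous (stay x n).
Proof.
case: n => [|n] c; last exact/differentiable_continuous/derivable1_diffP/derivable_stay.
rewrite (_ : stay x 0 = cst 1); first exact: cvg_cst.
by apply/funext => z; rewrite /stay big_ord0 subr0.
Qed.

(** Induction on [n] by comparing derivatives: that of [e^c stay x n.+1 c] is
    [e^c stay x n (c + x)], at most [rho^n e^(t x) e^((1+t) c)]. As [e^(t x) = rho (1 + t)], this is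
    the derivative of [rho^(n+1) e^((1+t) c)]. *)
Lemma stay_le_geometric x (t : R) n c : 0 < x -> 0 < t -> 0 <= c ->
  stay x n c <= (expR (t * x) / (1 + t)) ^+ n * expR (t * c).
Proof.
move=> x0 t0; set rho := expR _ / _; elim: n c => [|n IH] c c0.
  rewrite /stay big_ord0 subr0 expr0 mul1r -[leLHS]expR0 ler_expR mulr_ge0//.
  exact: ltW.
pose D : R -> R := cst (rho ^+ n.+1) * (expR \o (cst (1 + t) * id)) - expR * stay x n.+1.
have dD (z : R) : is_derive z 1 D
    (rho ^+ n.+1 * (expR ((1 + t) * z) * (1 + t)) - expR z * stay x n (z + x)).
  apply: is_derive_eq.
    by apply: is_deriveB; apply: is_deriveM; exact: is_derive_stay.
  by rewrite /GRing.scale/= ?fctE; ring.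
have rho_ge0 : 0 <= rho by rewrite divr_ge0 ?expR_ge0// addr_ge0// ltW.
have D0_ge0 : 0 <= D 0.
  by rewrite /D !fctE stay_at0 !mulr0 subr0 expR0 mulr1 exprn_ge0.
suff : 0 <= D c.
  rewrite /D !fctE subr_ge0 mulrDl mul1r expRD => H.
  by rewrite -(ler_pM2l (expR_gt0 c)) mulrCA.
apply: (le_trans D0_ge0); apply: (@ger0_derive1_ndecry _ D 0) => //.
- move=> z; rewrite in_itv/= andbT => z0; rewrite derive1E; have [_ ->] := dD z.
  rewrite subr_ge0; have zx0 : 0 <= z + x by rewrite addr_ge0// ltW.
  apply: (le_trans (ler_wpM2l (expR_ge0 z) (IH _ zx0))).
  rewrite exprS mulrDr expRD [(1 + t) * z]mulrDl mul1r expRD.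
  rewrite le_eqVlt; apply/orP; left; apply/eqP.
  by rewrite {2}/rho; field; rewrite gt_eqF// addr_gt0.
- apply: continuous_subspaceT => z.
  by apply/differentiable_continuous/derivable1_diffP; have [] := dD z.
Qed.

Lemma integral_stay x n c : 0 <= c ->
  (\int[lebesgue_measure]_(y in `[0%R, c]) (expR (- y) * stay x n (c - y + x))%:E
   = (stay x n.+1 c)%:E)%E.
Proof.
rewrite le_eqVlt => /predU1P[<-|c0].
  by rewrite set_itv1 integral_set1 stay_at0.
(* In the derivative of [- e^(-y) stay x n.+1 (c - y)] the two terms with [stay x n.+1] cancel; it
   vanishes at [y = c] by [stay_at0]. *)
pose G : R -> R := - ((expR \o -%R) * (stay x n.+1 \o (cst c - id))).
have dG (y : R) : is_derive y 1 G (expR (- y) * stay x n (c - y + x)).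
  apply: is_derive_eq.
    apply: is_deriveN; apply: is_deriveM.
    by apply: is_derive1_comp; exact: is_derive_stay.
  by rewrite /GRing.scale/= ?fctE; ring.
have cG : continuous G.
  by move=> y; apply/differentiable_continuous/derivable1_diffP; have [] := dG y.
rewrite (@continuous_FTC2 _ _ G)//.
- rewrite /G !fctE subrr stay_at0 subr0 oppr0 expR0 mulr0 oppr0 mul1r.
  by rewrite sub0e EFinN oppeK.
- apply: continuous_subspaceT => y; apply: cvgM.
    by apply: continuous_comp; [exact: opp_continuous|exact: continuous_expR].
  apply: (@continuous_comp _ _ _ (fun y => c - y + x) (stay x n)); last exact: continuous_stay.
  by apply: cvgD; [apply: cvgB; [exact: cvg_cst|exact: cvg_id]|exact: cvg_cst].
- split; [by move=> y _; have [] := dG y| |].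
  + exact/cvg_at_right_filter/cG.
  + exact/cvg_at_left_filter/cG.
- by move=> y _; rewrite derive1E; have [_ ->] := dG y.
Qed.

End stay.

(** * The law of the crossing level *)

(** The Radon-Nikodym derivative of [nu] satisfies the formula, and it equals [p] almost everywhere
    because both have integral [nu A] over every measurable [A]. *)
Lemma ge0_integral_density d (T : measurableType d) (R : realType)
    (mu : {sigma_finite_measure set T -> \bar R})
    (nu : {finite_measure set T -> \bar R}) (p : T -> R) (f : T -> \bar R) :
  measurable_fun setT p -> (forall x, 0 <= p x) ->
  (forall A, measurable A -> nu A = \int[mu]_(x in A) (p x)%:E)%E ->
  measurable_fun setT f -> (forall x, 0 <= f x)%E ->
  (\int[nu]_x f x = \int[mu]_x (f x * (p x)%:E))%E.
Proof.
move=> mp p0 nuE mf f0.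
have mEp : measurable_fun setT (EFin \o p) by exact/measurable_EFinP.
have numu : nu `<< mu.
  apply/null_content_dominatesP => A mA muA0; rewrite nuE//.
  by rewrite null_set_integral//; exact: measurable_funTS.
rewrite -(Radon_Nikodym_SigmaFinite.change_of_variables numu)//.
have mRN := measurable_int _ (Radon_Nikodym_SigmaFinite.f_integrable numu).
have nu_fin : (\int[mu]_x (p x)%:E < +oo)%E by rewrite -nuE// ltey_eq fin_num_measure.
have ip : mu.-integrable setT (EFin \o p).
  apply/integrableP; split => //.
  by under eq_integral do rewrite /= ger0_norm//.
apply: ae_eq_integral => //.
- exact: emeasurable_funM.
- exact: emeasurable_funM.
- apply: ae_eqe_mul2l; apply: integral_ae_eq => //.
    exact: Radon_Nikodym_SigmaFinite.f_integrable.
  move=> A _ mA.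
  by rewrite -nuE// -Radon_Nikodym_SigmaFinite.f_integral.
Qed.

(** Uniqueness of product measures: the law of the pair under [P] restricted to [D] agrees on
    rectangles with the product of [nu] and [mu] scaled by [P D]. *)
Lemma joint_law d (T : measurableType d) (R : realType) (P : probability T R)
    (D : set T) (U V : {mfun T >-> R}) (mu nu : probability R R) :
  measurable D ->
  (forall A B, measurable A -> measurable B ->
    P (D `&` (U @^-1` A `&` V @^-1` B)) = P D * (mu A * nu B))%E ->
  forall C : set (R * R), measurable C ->
    P (D `&` (fun w => (U w, V w)) @^-1` C) = (P D * (mu \x nu) C)%E.
Proof.
move=> mD DUV C mC.
pose UV w := (U w, V w).
have mUV : measurable_fun setT UV.
  by apply/measurable_fun_pairP; split; exact: measurable_funPT.
have PD0 : 0 <= fine (P D) by exact: fine_ge0.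
have PDE : P D = (fine (P D))%:E by rewrite fineK// fin_num_measure.
rewrite setIC -[LHS]/(pushforward (mrestr P mD) UV C).
rewrite -(@product_measure_unique _ _ _ _ R (mscale (NngNum PD0) mu) nu)//.
  rewrite /product_measure1 ge0_integral_mscale//= -?PDE//.
  exact: measurable_fun_xsection.
move=> A B mA mB.
by rewrite -[LHS]/(P (UV @^-1` (A `*` B) `&` D)) setIC /mscale/= -muleA -PDE -DUV.
Qed.

(** For [0 < x] and nonnegative [X], the least [c >= 0] such that
    [X_k + ... + X_(k+i) <= c + i x] for all [i < n]. *)
Fixpoint level (d : measure_display) (T : measurableType d) (R : realType)
    (X : nat -> {mfun T >-> R}) (x : R) (k n : nat) (w : T) : R :=
  if n is m.+1 then X k w + Num.max 0 (level X x k.+1 m w - x) else 0.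

Lemma measurable_level d (T : measurableType d) (R : realType)
  (X : nat -> {mfun T >-> R}) (x : R) (k n : nat) :
  measurable_fun setT (level X x k n).
Proof.
elim: n k => [|n IH] k /=; first exact: measurable_cst.
apply: measurable_funD => //; apply: measurable_maxr => //.
exact: measurable_funB.
Qed.

HB.instance Definition _ d (T : measurableType d) (R : realType)
    (X : nat -> {mfun T >-> R}) (x : R) (k n : nat) :=
  isMeasurableFun.Build _ _ T R (level X x k n) (measurable_level X x k n).

(** The constraint [i = 0] reads [X k <= c], which is the role of [Num.max 0]. After removal of
    [X k], the others are the constraints of the tail with [c - X k + x] in place of [c]. *)
Lemma level_leP d (T : measurableType d) (R : realType)
    (X : nat -> {mfun T >-> R}) (x c : R) (k n : nat) (w : T) :
  0 < x -> 0 <= c ->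
  level X x k n w <= c <->
  forall i, (i < n)%N -> \sum_(j < i.+1) X (k + j)%N w <= c + i%:R * x.
Proof.
move=> x0; elim: n k c => [|n IH] k c c0 /=; first by split.
have sumS i : \sum_(j < i.+2) X (k + j)%N w =
    X k w + \sum_(j < i.+1) X (k.+1 + j)%N w.
  rewrite big_ord_recl addn0; congr (_ + _).
  by apply: eq_bigr => j _; rewrite addSnnS.
rewrite -lerBrDl ge_max subr_ge0 lerBlDr; split.
- case/andP => Xc; have cx0 : 0 <= c - X k w + x by rewrite addr_ge0 ?subr_ge0// ltW.
  move=> /(IH _ _ cx0) H [_|i]; first by rewrite big_ord1 addn0 mul0r addr0.
  rewrite ltnS => /H; rewrite sumS -natr1; lra.
- move=> H; have Xc : X k w <= c.
    by have := H 0%N isT; rewrite big_ord1 addn0 mul0r addr0.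
  have cx0 : 0 <= c - X k w + x by rewrite addr_ge0 ?subr_ge0// ltW.
  rewrite Xc/=; apply/(IH _ _ cx0) => i /(H i.+1).
  rewrite sumS -natr1; lra.
Qed.

(** The event [D] is independent of the family of the [X j] with [k <= j]. Keeping
    [D] general lets the induction on [n] for [level X x k n] absorb [X k] into it. *)
Definition indep_from d (T : measurableType d) (R : realType)
    (P : probability T R) (X : nat -> {RV P >-> R}) (k : nat) (D : set T) : Prop :=
  forall (J : {fset nat}) (A : nat -> set R),
    (forall j, j \in J -> (k <= j)%N) -> (forall j, measurable (A j)) ->
    P (D `&` \bigcap_(j in [set` J]) (X j @^-1` A j)) =
      (P D * \prod_(j <- J) P (X j @^-1` A j))%E.

Section level_law.
Context d (T : measurableType d) (R : realType) (P : probability T R).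
Variables (X : nat -> {RV P >-> R}) (x : R).
Hypothesis X_exp : forall n, exponential_with_mean 1 (X n).
Hypothesis x0 : 0 < x.

Local Notation law n := (distribution P (level X x 0 n : {RV P >-> R})).

Lemma indep_from_setT k : mutually_independent X -> indep_from X k setT.
Proof. by move=> Xi J A _ mA; rewrite setTI Xi// probability_setT mul1e. Qed.

Lemma indep_from1 k D A : indep_from X k D -> measurable A ->
  P (D `&` X k @^-1` A) = (P D * P (X k @^-1` A))%E.
Proof.
move=> Dk mA; have := Dk [fset k]%fset (fun=> A).
rewrite big_seq_fset1 (_ : \bigcap_(j in _) _ = X k @^-1` A); last first.
  by rewrite set_fset1 bigcap_set1.
by apply=> // j; rewrite inE => /eqP ->.
Qed.

Lemma indep_fromS k D A : indep_from X k D -> measurable A ->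
  indep_from X k.+1 (D `&` X k @^-1` A).
Proof.
move=> Dk mA J B kJ mB.
have kNJ : k \notin J by apply/negP => /kJ; rewrite ltnn.
(* Prescribing [A] at [k] reduces the claim to the product formula for [D] over [k] and [J]
   together. *)
pose B' j := if j == k then A else B j.
have JB' (j : nat) : j \in J -> B' j = B j.
  by move=> jJ; rewrite /B' ifN//; apply: contraNneq kNJ => <-.
have := Dk (k |` J)%fset B'.
rewrite big_fsetU1//= [B' k]/B' eqxx muleA -indep_from1//.
under eq_big_seq => j jJ do rewrite JB'//.
move=> <-; first last.
- by move=> j; rewrite /B'; case: ifP.
- by move=> j; rewrite !inE => /predU1P[->//|/kJ/ltnW].
congr (P _); rewrite -setIA; congr (_ `&` _).
rewrite set_fsetU1 bigcap_setU1 {1}/B' eqxx; congr (_ `&` _).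
by apply: eq_bigcapr => j /JB' ->.
Qed.

Lemma law_X k A : measurable A -> P (X k @^-1` A) = distribution P (X 0) A.
Proof. by move=> mA; rewrite (X_exp 0 mA) -(X_exp k mA). Qed.

(** [level X x k n.+1] is [step] of the pair formed by [X k] and [level X x k.+1 n]. *)
Let step (z : R * R) : R := z.1 + Num.max 0 (z.2 - x).

Let measurable_step : measurable_fun setT step.
Proof.
apply: measurable_funD => //; apply: measurable_maxr => //.
exact: measurable_funB.
Qed.

(** By [indep_fromS] the induction hypothesis applies to [D] cut by an event of [X k], so
    [joint_law] gives the product. The right side does not depend on [k], and involves [D] only
    through [P D]: this carries both independence and stationarity. *)
Lemma level_law_step n :
  (forall k D, measurable D -> indep_from X k D -> forall B, measurable B ->
    P (D `&` level X x k n @^-1` B) = P D * law n B)%E ->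
  forall k D, measurable D -> indep_from X k D -> forall B, measurable B ->
    P (D `&` level X x k n.+1 @^-1` B) =
      (P D * (distribution P (X 0) \x law n) (step @^-1` B))%E.
Proof.
move=> IH k D mD Dk B mB.
rewrite -[level X x k n.+1 @^-1` B]/
  ((fun w => (X k w, level X x k.+1 n w)) @^-1` (step @^-1` B)).
apply: joint_law => // [A C mA mC|]; last first.
  by rewrite -[X in measurable X]setTI; exact: measurable_step.
rewrite setIA (IH k.+1)//; last exact: indep_fromS.
  by rewrite indep_from1// law_X// muleA.
by apply: measurableI => //; exact: measurable_funPTI.
Qed.

Hypothesis X_indep : mutually_independent X.

Lemma level_indep n k D : measurable D -> indep_from X k D ->
  forall B, measurable B -> P (D `&` level X x k n @^-1` B) = (P D * law n B)%E.
Proof.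
elim: n k D => [|n IH] k D mD Dk B mB.
  rewrite /distribution/pushforward/= !preimage_cst.
  by case: ifP; rewrite ?setIT ?setI0 ?probability_setT ?measure0 ?mule1 ?mule0.
rewrite level_law_step//; congr (_ * _)%E.
(* The instance [k = 0], [D = setT] identifies the product measure of the event with
   [law n.+1 B]. *)
have := level_law_step IH measurableT (@indep_from_setT 0 X_indep) mB.
by rewrite setTI probability_setT mul1e.
Qed.

Lemma law_recE n B : measurable B ->
  law n.+1 B = (distribution P (X 0) \x law n)%E (step @^-1` B).
Proof.
move=> mB.
have := level_law_step (@level_indep n) measurableT (@indep_from_setT 0 X_indep) mB.
by rewrite setTI probability_setT mul1e.
Qed.

Lemma ge0_integral_law_X0 (f : R -> \bar R) : measurable_fun setT f ->
  (forall y, 0 <= f y)%E ->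
  (\int[distribution P (X 0)]_y f y =
   \int[lebesgue_measure]_y (f y * (exponential_pdf 1 y)%:E))%E.
Proof.
move=> mf f0.
rewrite ge0_integral_distribution//.
(* [R] and [measurableTypeR R] have the same measurable sets but different
   displays; integrating over [P] moves from one to the other. *)
pose X' := HB.pack_for {RV P >-> measurableTypeR R} (X 0 : T -> measurableTypeR R)
  (isMeasurableFun.Build _ _ T (measurableTypeR R) _ (measurable_funPT (X 0))).
transitivity (\int[distribution P X']_y f y)%E.
  by rewrite ge0_integral_distribution.
rewrite (@ge0_integral_density _ _ _ lebesgue_measure _ (exponential_pdf 1))//.
- exact: measurable_exponential_pdf.
- by move=> y; exact: exponential_pdf_ge0.
- by move=> A mA; rewrite [LHS](X_exp 0 mA) invr1.
Qed.

(** Integrating [law_recE] over the first variable gives the recursion that [integral_stay]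
    solves. *)
Lemma law_levelE n c : 0 <= c -> law n `]-oo, c] = (stay x n c)%:E.
Proof.
elim: n c => [|n IH] c c0.
  rewrite /distribution/pushforward/= preimage_cst mem_set ?probability_setT; last first.
    by rewrite /= in_itv.
  by rewrite /stay big_ord0 subr0.
rewrite law_recE// /product_measure1 ge0_integral_law_X0//; last first.
  apply: measurable_fun_xsection.
  by rewrite -[X in measurable X]setTI; exact: measurable_step.
rewrite -integral_stay// [RHS]integral_mkcond; apply: eq_integral => y _.
rewrite patchE mem_setE in_itv/=; case: ifPn => [/andP[y0 yc]|].
- rewrite exponential_pdfE// mul1r mulN1r muleC EFinM; congr (_ * _)%E.
  rewrite -IH; last by rewrite addr_ge0 ?subr_ge0// ltW.
  (* For [y <= c], [y + max 0 (m - x) <= c] amounts to [m <= c - y + x]. *)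
  congr (law n _); apply/seteqP; split => m /=; rewrite /xsection/= inE/= in_itv/= /step/=.
  + by rewrite in_itv/= -lerBrDl ge_max subr_ge0 yc lerBlDr.
  + by rewrite in_itv/= -lerBrDl ge_max subr_ge0 yc lerBlDr.
(* Outside [[0, c]] the integrand vanishes: the density is zero for [y < 0], and the section is
   empty for [y > c]. *)
- rewrite negb_and -!ltNge => /orP[y0|cy].
    by rewrite lt0_exponential_pdf// mule0.
  rewrite (_ : xsection _ _ = set0) ?measure0 ?mul0e//.
  apply/seteqP; split => m //=; rewrite /xsection/= inE/= in_itv/= /step/=.
  by rewrite leNgt (lt_le_trans cy)// lerDl le_max lexx.
Qed.

(** At [c = x] the bound on the sum of the first [i.+1] variables is [x + i x = i.+1 x], a bound by
    [x] on their mean. *)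
Lemma sup_running_mean_leP w :
  (sup_running_mean X w <= x%:E)%E <-> forall n, level X x 0 n w <= x.
Proof.
split=> [Zx n|H].
  apply/level_leP => //; first exact: ltW.
  move=> i _; under eq_bigr do rewrite add0n.
  have : ((running_mean X i w)%:E <= x%:E)%E.
    by apply: le_trans Zx; apply: ereal_sup_ubound; exists i.
  by rewrite lee_fin /running_mean ler_pdivrMr// -natr1; lra.
apply: ge_ereal_sup => _ [n _ <-].
have /level_leP := H n.+1; move=> /(_ x0 (ltW x0) n (leqnn _)).
under eq_bigr do rewrite add0n.
by rewrite lee_fin /running_mean ler_pdivrMr// -[n.+1%:R]natr1; lra.
Qed.

(** Continuity of [P] from above along the decreasing events that the first [n] means are at most
    [x]. *)
Lemma cvg_stay_distribution :
  stay x n x @[n --> \oo] -->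
    distribution_function (sup_running_mean X : {RV P >-> \bar R}) x.
Proof.
pose E n := level X x 0 n @^-1` `]-oo, x].
have mE n : measurable (E n) by exact: measurable_funPTI.
have ZE : sup_running_mean X @^-1` [set z | (z <= x%:E)%E] = \bigcap_n E n.
  apply/seteqP; split => w /=.
    by move=> /sup_running_mean_leP H n _; rewrite /E/= in_itv/=.
  move=> H; apply/sup_running_mean_leP => n.
  by have := H n I; rewrite /E/= in_itv.
have cE : P (E n) @[n --> \oo] --> P (\bigcap_n E n).
  apply: nonincreasing_cvg_mu => //.
  - by rewrite ltey_eq fin_num_measure.
  - exact: bigcap_measurable.
  - move=> m n mn; apply/subsetPset => w; rewrite /E/= !in_itv/=.
    move=> /(level_leP _ _ _ _ x0 (ltW x0)) H; apply/level_leP => //.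
      exact: ltW.
    by move=> i im; apply: H; exact: leq_trans im mn.
rewrite /distribution_function /distribution /pushforward ZE.
have -> : (fun n => stay x n x) = (fun n => fine (P (E n))).
  apply/funext => n; have := law_levelE n (ltW x0).
  by rewrite /distribution /pushforward -/(E n) => ->.
apply: fine_cvg; rewrite fineK//.
by rewrite fin_num_measure//; exact: bigcap_measurable.
Qed.

End level_law.

(** * The quantile function *)

Definition quantile (R : realType) (u : R) : R := - ln (1 - u) / u.

Section quantile.
Context {R : realType}.
Implicit Types u x : R.

Lemma quantile_gt1 u : 0 < u < 1 -> 1 < quantile u.
Proof.
move=> /andP[u0 u1]; rewrite /quantile ltr_pdivlMr// mul1r ltrNr.
rewrite -[ltRHS]expRK ltr_ln ?posrE ?expR_gt0 ?subr_gt0//.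
by apply: expR_gt1Dx; rewrite oppr_eq0 gt_eqF.
Qed.

(** Follows from [1 / (1 - u) = 1 + u / (1 - u) < e^(u / (1 - u))]. It places the second solution of
    [y e^(-y) = x e^(-x)] below [1], and later gives the sign of the derivative of [quantile]. *)
Lemma quantile_lt u : 0 < u < 1 -> quantile u * (1 - u) < 1.
Proof.
move=> /andP[u0 u1]; have u10 : 0 < 1 - u by rewrite subr_gt0.
suff : - ln (1 - u) < u / (1 - u).
  by rewrite /quantile ltr_pdivlMr// mulrAC ltr_pdivrMr// mul1r.
rewrite -lnV ?posrE// -[ltRHS]expRK ltr_ln ?posrE ?expR_gt0 ?invr_gt0//.
rewrite [ltLHS](_ : _ = 1 + u / (1 - u)); last by field; rewrite gt_eqF.
by apply: expR_gt1Dx; rewrite gt_eqF// divr_gt0.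
Qed.

Lemma expR_quantile u : 0 < u < 1 -> expR (- (quantile u * u)) = 1 - u.
Proof.
move=> /andP[u0 u1].
by rewrite /quantile divfK ?gt_eqF// opprK lnK// posrE subr_gt0.
Qed.

Lemma quantile_surj x : 1 < x -> exists2 u, 0 < u < 1 & quantile u = x.
Proof.
move=> x1; have x0 : 0 < x by exact: lt_trans x1.
pose f u := 1 - u - expR (- (u * x)).
(* [f] also vanishes at [0], so the intermediate value theorem needs a positive left end where
   [f > 0]. Since [e^(-r x) <= 1 / (1 + r x)], it suffices that [(1 - r) (1 + r x) > 1], that is
   [r x < x - 1]. *)
pose r := (x - 1) / (2 * x).
have r0 : 0 < r by rewrite divr_gt0 ?subr_gt0// mulr_gt0.
have rx : r * x = (x - 1) / 2 by rewrite /r; field; rewrite gt_eqF.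
have r1 : r < 1 by rewrite /r ltr_pdivrMr ?mulr_gt0//; lra.
have fr : 0 < f r.
  rewrite /f subr_gt0 expRN.
  have H : 1 + r * x <= expR (r * x) by exact: expR_ge1Dx.
  apply: (@le_lt_trans _ _ (1 + r * x)^-1).
    by rewrite lef_pV2 ?posrE ?expR_gt0// addr_gt0// mulr_gt0.
  rewrite -[ltLHS]mul1r ltr_pdivrMr; last by rewrite addr_gt0// mulr_gt0.
  have : r * (r * x) < r * (x - 1) by rewrite ltr_pM2l// rx; lra.
  lra.
have f1 : f 1 < 0 by rewrite /f subrr sub0r oppr_lt0 expR_gt0.
have cf : continuous f.
  move=> u; apply: cvgB.
    by apply: cvgB; [exact: cvg_cst|exact: cvg_id].
  apply: (@continuous_comp _ _ _ (fun u => - (u * x)) expR); last exact: continuous_expR.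
  by apply: cvgN; apply: cvgM; [exact: cvg_id|exact: cvg_cst].
have [|u] := @IVT _ f r 1 0 (ltW r1) (continuous_subspaceT cf).
  by rewrite ge_min (ltW f1) orbT le_max (ltW fr).
rewrite in_itv/= => /andP[ru u1] fu.
have u_lt1 : u < 1.
  by rewrite lt_neqAle u1 andbT; apply/eqP => uE; move: f1; rewrite -uE fu ltxx.
exists u; first by rewrite (lt_le_trans r0)//= u_lt1.
move/eqP: fu; rewrite /f subr_eq0 => /eqP fu.
rewrite /quantile fu expRK opprK mulrC mulKf// gt_eqF//.
exact: lt_le_trans ru.
Qed.

Lemma is_derive_quantile u : 0 < u < 1 ->
  is_derive u 1 (@quantile R) ((1 - quantile u * (1 - u)) / (u * (1 - u))).
Proof.
move=> /andP[u0 u1].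
have -> : @quantile R = (- (@ln R \o (cst 1 - id))) * (fun v => v^-1).
  by apply/funext => v.
have u10 : 0 < (cst 1 - id) u by rewrite !fctE subr_gt0.
have dl := is_derive1_ln u10.
have dV : is_derive u 1 (fun v : R => v^-1) (- u ^- 2 *: 1).
  by apply: is_deriveV; rewrite gt_eqF.
apply: is_derive_eq.
rewrite /GRing.scale/= !fctE /quantile; field.
by rewrite gt_eqF// gt_eqF.
Qed.

End quantile.

(** The derivative of [F], from differentiating [e^(- x F x) = 1 - F x]. *)
Definition quantile_density (R : realType) (F : R -> R) (x : R) : R :=
  if 1 < x then F x * (1 - F x) / (1 - x * (1 - F x)) else 0.

Lemma quantile_density_eq0 (R : realType) (F : R -> R) (x : R) :
  x <= 1 -> quantile_density F x = 0.
Proof. by move=> x1; rewrite /quantile_density ltNge x1. Qed.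

(** * The limit of [stay x n x]: inversion, derivative and tail integral *)

Section stay_limit.
Context {R : realType} (F : R -> R).
Hypothesis F_nd : {homo F : x y / x <= y}.
Hypothesis F_ge0 : forall x, 0 <= F x.
Hypothesis cvg_F : forall x, 0 < x -> stay x n x @[n --> \oo] --> F x.

Lemma stay_limit_eq0 x : x < 1 -> F x = 0.
Proof.
(* For [x <= 0], where [cvg_F] says nothing, monotonicity compares with the value at [1/2]. *)
wlog x0 : x / 0 < x => [H|x1].
  have [/H//|x0 _] := ltP 0 x.
  apply/eqP; rewrite eq_le F_ge0 andbT -(H 2^-1) ?invr_gt0//; last by rewrite invf_lt1// ltr1n.
  by apply: F_nd; rewrite (le_trans x0)// invr_ge0.
(* [rho < 1] follows from [e^(t x) <= 1 / (1 - t x)] and [(1 + t) (1 - t x) = 1 + t (1 - x - t x) >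
   1]. *)
pose t := (1 - x) / 2.
have t0 : 0 < t by rewrite divr_gt0// subr_gt0.
have tx1 : t * x < 1 - x by rewrite /t -mulrA gtr_pMr ?subr_gt0//; lra.
pose rho := expR (t * x) / (1 + t).
have rho0 : 0 <= rho by rewrite divr_ge0 ?expR_ge0// addr_ge0// ltW.
have rho1 : rho < 1.
  rewrite ltr_pdivrMr ?addr_gt0// mul1r.
  have tx : 0 < 1 - t * x by lra.
  apply: (@le_lt_trans _ _ (1 - t * x)^-1).
    rewrite -[leLHS]invrK -expRN lef_pV2 ?posrE ?expR_gt0//.
    exact: (expR_ge1Dx (- (t * x))).
  have t1 : 0 < 1 + t by rewrite addr_gt0.
  rewrite invf_plt ?posrE// -div1r ltr_pdivrMr//.
  have : t * (t * x) < t * (1 - x) by rewrite ltr_pM2l.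
  lra.
apply/eqP; rewrite eq_le F_ge0 andbT.
have -> : 0 = 0 * expR (t * x) :> R by rewrite mul0r.
have H : rho ^+ n * expR (t * x) @[n --> \oo] --> 0 * expR (t * x).
  apply: cvgM; last exact: cvg_cst.
  by apply: cvg_expr; rewrite ger0_norm.
apply: (ler_cvg_to (cvg_F x0) H); near=> n.
by apply: stay_le_geometric => //; exact: ltW.
Unshelve. all: by end_near. Qed.

Lemma stay_limit_series x : 0 < x ->
  \sum_(1 <= k < n) (k ^ k.-1)%N%:R / (k`!)%:R * x ^+ k.-1 * expR (- (k%:R * x))
    @[n --> \oo] --> 1 - F x.
Proof.
move=> x0; rewrite -cvg_shiftS/=.
rewrite (_ : (fun _ => _) = (fun n => 1 - stay x n x)).
  by apply: cvgB; [exact: cvg_cst|exact: cvg_F].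
by apply/funext => n; rewrite staySE subKr.
Qed.

(** Already for finite [n], multiplying by [z] turns the terms into [k^(k-1) / k! (z e^(-z))^k],
    partial sums of the tree function at [z e^(-z)]. *)
Lemma stay_limit_invariant x y : 0 < x -> 0 < y ->
  x * expR (- x) = y * expR (- y) -> x * (1 - F x) = y * (1 - F y).
Proof.
move=> x0 y0 xy.
have stayE z n : z * (1 - stay z n z) = \sum_(1 <= k < n.+1)
    (k ^ k.-1)%N%:R / (k`!)%:R * (z * expR (- z)) ^+ k.
  rewrite staySE subKr mulr_sumr; apply: eq_big_nat => -[//|k] _.
  by rewrite /= exprMn exprS -expRM_natl mulrN; ring.
have cvg z : 0 < z -> z * (1 - stay z n z) @[n --> \oo] --> z * (1 - F z).
  move=> z0; apply: cvgM; first exact: cvg_cst.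
  by apply: cvgB; [exact: cvg_cst|exact: cvg_F].
apply: (cvg_unique _ (cvg x x0)) => //.
rewrite (_ : (fun _ => _) = (fun n => y * (1 - stay y n y))); first exact: cvg.
by apply/funext => n; rewrite !stayE xy.
Qed.

Lemma stay_limit_quantile u : 0 < u < 1 -> F (quantile u) = u.
Proof.
move=> u01; have /andP[u0 u1] := u01.
have q1 := quantile_gt1 u01; have q0 := lt_trans ltr01 q1.
pose y := quantile u * (1 - u).
have y0 : 0 < y by rewrite mulr_gt0// subr_gt0.
(* Replace [1 - u] by [e^(- quantile u * u)] and add the exponents. *)
have E : quantile u * expR (- quantile u) = y * expR (- y).
  rewrite /y -mulrA; congr (_ * _).
  by rewrite -{1}(expR_quantile u01) -expRD; congr expR; ring.
have := stay_limit_invariant q0 y0 E.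
rewrite (stay_limit_eq0 (quantile_lt u01)) subr0 mulr1 /y.
by move=> /(mulfI (lt0r_neq0 q0)); lra.
Qed.

(** Monotonicity gives [F 1 <= F (quantile u) = u] for every [u] in []0, 1[]; the [1 / 2] in the
    minimum keeps [u] below [1]. *)
Lemma stay_limit1 : F 1 = 0.
Proof.
apply/eqP; rewrite eq_le F_ge0 andbT; apply/ler_addgt0Pl => e e0; rewrite addr0.
pose u := Num.min e (1 / 2).
have u01 : 0 < u < 1 by rewrite lt_min e0 gt_min; apply/andP; split; [|apply/orP; right]; lra.
apply: (@le_trans _ _ u); last by rewrite ge_min lexx.
rewrite -[leRHS](stay_limit_quantile u01); apply: F_nd.
exact/ltW/quantile_gt1.
Qed.

Lemma stay_limit_itv x : 1 < x -> 0 < F x < 1.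
Proof. by move=> /quantile_surj[u u01 <-]; rewrite stay_limit_quantile. Qed.

Lemma quantile_stay_limit x : 1 < x -> quantile (F x) = x.
Proof. by move=> /quantile_surj[u u01 <-]; rewrite stay_limit_quantile. Qed.

Lemma stay_limit_bij : set_bij `]1, +oo[ `]0, 1[ F.
Proof.
split.
- by move=> x/=; rewrite !in_itv/= andbT; exact: stay_limit_itv.
- move=> x y; rewrite !inE/= !in_itv/= !andbT => x1 y1 xy.
  by rewrite -(quantile_stay_limit x1) xy quantile_stay_limit.
- move=> u/=; rewrite in_itv/= => u01; exists (quantile u).
    by rewrite /= in_itv/= quantile_gt1.
  exact: stay_limit_quantile.
Qed.

Lemma stay_limit_pinv u : 0 < u < 1 -> 'pinv_(fun=> 0) `]1, +oo[ F u = quantile u.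
Proof.
move=> u01; have [_ Finj _] := stay_limit_bij.
rewrite -{1}(stay_limit_quantile u01) pinvKV// inE/= in_itv/= andbT.
exact: quantile_gt1.
Qed.

(** Beyond [quantile u] monotonicity keeps [F] at least [u], and [u] may be as close to [1] as
    desired. *)
Lemma cvg_stay_limit_pinfty : F x @[x --> +oo] --> (1 : R).
Proof.
have F_le1 x : F x <= 1.
  have [/stay_limit_itv/andP[_ /ltW//]|x1] := ltP 1 x.
  by rewrite (le_trans (F_nd x1))// stay_limit1.
apply/cvgrPdist_le => e e0; near=> x.
rewrite ger0_norm ?subr_ge0// lerBlDr -lerBlDl.
pose u := Num.max (1 - e) (1 / 2).
have u01 : 0 < u < 1.
  by rewrite gt_max lt_max; apply/andP; split; [apply/orP; right|apply/andP; split]; lra.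
apply: (@le_trans _ _ u); first by rewrite le_max lexx.
rewrite -[leLHS](stay_limit_quantile u01); apply: F_nd.
by near: x; apply: nbhs_pinfty_ge; rewrite num_real.
Unshelve. all: by end_near. Qed.

Lemma quantile_density_den (x : R) : 1 < x -> 0 < 1 - x * (1 - F x).
Proof.
move=> x1; rewrite subr_gt0 -{1}(quantile_stay_limit x1).
exact/quantile_lt/stay_limit_itv.
Qed.

Lemma quantile_density_gt0 (x : R) : 1 < x -> 0 < quantile_density F x.
Proof.
move=> x1; have /andP[F0 F1] := stay_limit_itv x1.
by rewrite /quantile_density x1 divr_gt0 ?mulr_gt0 ?subr_gt0// -subr_gt0 quantile_density_den.
Qed.

Lemma quantile_density_ge0 (x : R) : 0 <= quantile_density F x.
Proof.
have [/quantile_density_gt0/ltW//|x1] := ltP 1 x.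
by rewrite quantile_density_eq0.
Qed.

(** Inverse function rule: near [F x], [F] undoes the continuous [quantile], whose derivative at
    [F x] is nonzero. *)
Lemma is_derive_stay_limit (x : R) : 1 < x -> is_derive x 1 F (quantile_density F x).
Proof.
move=> x1; have u01 := stay_limit_itv x1; have /andP[u0 u1] := u01.
have nearu : \forall u \near F x, 0 < u < 1.
  near=> u; apply/andP; split; near: u; [exact: lt_nbhsr|exact: lt_nbhsl].
have -> : quantile_density F x = ((1 - x * (1 - F x)) / (F x * (1 - F x)))^-1.
  by rewrite /quantile_density x1 invf_div.
rewrite -{1 2}(quantile_stay_limit x1).
apply: is_derive_inverse.
- by apply: filterS nearu => u; exact: stay_limit_quantile.
- apply: filterS nearu => u /is_derive_quantile[du _].
  exact/differentiable_continuous/derivable1_diffP.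
- exact: is_derive_quantile.
- rewrite quantile_stay_limit// mulf_neq0 ?gt_eqF ?quantile_density_den//.
  by rewrite invr_gt0 mulr_gt0// subr_gt0.
Unshelve. all: by end_near. Qed.

Lemma continuous_stay_limit (x : R) : 1 < x -> {for x, continuous F}.
Proof.
by move=> /is_derive_stay_limit[dF _]; exact/differentiable_continuous/derivable1_diffP.
Qed.

Lemma continuous_quantile_density (x : R) : x != 1 -> {for x, continuous (quantile_density F)}.
Proof.
rewrite neq_lt => /orP[x1|x1].
  rewrite /prop_for/= /continuous_at (quantile_density_eq0 _ (ltW x1)).
  apply: cvg_near_cst; near=> y.
  have y1 : y < 1 by near: y; exact: lt_nbhsl.
  exact: quantile_density_eq0 (ltW y1).
have cF := continuous_stay_limit x1.
have dE : quantile_density F x = F x * (1 - F x) / (1 - x * (1 - F x)).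
  by rewrite /quantile_density x1.
rewrite /prop_for/= /continuous_at dE.
have cF1 : 1 - F y @[y --> x] --> 1 - F x by apply: cvgB => //; exact: cvg_cst.
have cD : 1 - y * (1 - F y) @[y --> x] --> 1 - x * (1 - F x).
  by apply: cvgB; [exact: cvg_cst|apply: cvgM => //; exact: cvg_id].
have cDV := cvgV (lt0r_neq0 (quantile_density_den x1)) cD.
apply: cvg_trans; last exact: (cvgM (cvgM cF cF1) (cDV _)).
apply: near_eq_cvg; near=> y; rewrite /quantile_density ifT//.
by near: y; exact: lt_nbhsr.
Unshelve. all: by end_near. Qed.

Lemma measurable_quantile_density : measurable_fun setT (quantile_density F).
Proof.
rewrite -(setvU `]1, +oo[) setCitvr; apply/measurable_funU => //; split.
  apply: (@eq_measurable_fun _ _ _ _ _ (cst (0 : R))); last exact: measurable_cst.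
  by move=> x; rewrite inE/= in_itv/= => x1; rewrite quantile_density_eq0.
apply: open_continuous_measurable_fun; first exact: interval_open.
move=> x; rewrite inE/= in_itv/= andbT => x1.
by apply: continuous_quantile_density; rewrite gt_eqF.
Qed.

(** [F] is an antiderivative tending to [1] at infinity; [a > 1] keeps the closed half-line away
    from the jump of the density. *)
Lemma integral_quantile_density a : 1 < a ->
  (\int[lebesgue_measure]_(x in `]a, +oo[) (quantile_density F x)%:E = (1 - F a)%:E)%E.
Proof.
move=> a1; rewrite integral_itv_obnd_cbnd; last first.
  by apply/measurable_EFinP; apply: measurable_funTS; exact: measurable_quantile_density.
rewrite (@ge0_continuous_FTC2y _ _ F _ 1)//.
- by move=> x _; exact: quantile_density_ge0.
- apply/continuous_within_itvcyP; split.
    move=> x; rewrite in_itv/= andbT => ax.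
    by apply: continuous_quantile_density; rewrite gt_eqF// (lt_trans a1).
  by apply/cvg_at_right_filter/continuous_quantile_density; rewrite gt_eqF.
- exact: cvg_stay_limit_pinfty.
- by move=> x ax; have [] := is_derive_stay_limit (lt_trans a1 ax).
- exact/cvg_at_right_filter/continuous_stay_limit.
- move=> x; rewrite in_itv/= andbT => ax; rewrite derive1E.
  by have [_ ->] := is_derive_stay_limit (lt_trans a1 ax).
Qed.

End stay_limit.

(** * The density *)

(** Open right rays are closed under intersection and generate the Borel sets; those starting at
    [-n] exhaust the line. *)
Lemma measure_unique_itvoy (R : realType)
    (m1 : {finite_measure set (measurableTypeR R) -> \bar R})
    (m2 : {measure set (measurableTypeR R) -> \bar R}) :
  (forall a : R, m1 `]a, +oo[%classic = m2 `]a, +oo[%classic) ->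
  forall A, measurable A -> m1 A = m2 A.
Proof.
move=> m12 A mA; apply: (@measure_unique _ R (measurableTypeR R) (@RGenOInfty.G R)
  (fun n => `](- n%:R)%R, +oo[%classic)) => //.
- exact: RGenOInfty.measurableE.
- move=> _ _ [a ->] [b ->]; exists (Num.max a b).
  by apply/seteqP; split => z /=; rewrite !in_itv/= !andbT gt_max => /andP.
- by move=> n; exists (- n%:R).
- apply/seteqP; split => // z _; exists (Num.truncn `|z|).+1 => //=.
  rewrite in_itv/= andbT ltrNl (le_lt_trans (ler_norm _))// normrN.
  exact: truncnS_gt.
- by move=> _ [a ->]; exact: m12.
- by move=> n; rewrite ltey_eq fin_num_measure.
Qed.

Definition density_measure (R : realType) (f : R -> R)
    (A : set (measurableTypeR R)) : \bar R :=
  (\int[lebesgue_measure]_(x in A) (f x)%:E)%E.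

Lemma density_measure_sigma_additive (R : realType) (f : R -> R) :
  measurable_fun setT f -> (forall x, 0 <= f x) ->
  semi_sigma_additive (density_measure f).
Proof.
move=> mf f0 A mA tA mUA; rewrite /density_measure; apply: cvg_toP.
  apply: ereal_nondecreasing_is_cvgn => m n mn.
  apply: lee_sum_nneg_natr => // k _ _.
  by apply: integral_ge0 => x _; rewrite lee_fin.
rewrite ge0_integral_bigcup//=.
- by apply/measurable_EFinP; exact: measurable_funTS.
- by move=> x _; rewrite lee_fin.
Qed.

Section law_of_limit.
Context d (T : measurableType d) (R : realType) (P : probability T R).
Variable Z : {RV P >-> \bar R}.
Local Notation F := (distribution_function Z).
Hypothesis Z_neqNy : forall w, Z w != -oo%E.
Hypothesis cvg_F : forall x, 0 < x -> stay x n x @[n --> \oo] --> F x.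

Lemma measurable_le (x : R) : measurable [set z : \bar R | (z <= x%:E)%E].
Proof. by rewrite -set_itvNyc; exact: emeasurable_itv. Qed.

Lemma distribution_functionE x : (F x)%:E = P (Z @^-1` [set z | (z <= x%:E)%E]).
Proof.
rewrite /distribution_function fineK// fin_num_measure//; exact: measurable_le.
Qed.

Lemma distribution_function_ge0 x : 0 <= F x.
Proof. exact: fine_ge0. Qed.

Lemma distribution_function_nd : {homo F : x y / x <= y}.
Proof.
move=> x y xy; rewrite -lee_fin !distribution_functionE.
apply: le_measure; rewrite ?inE; try exact: (measurable_funPTI _ (measurable_le _)).
by move=> w /= /le_trans; apply; rewrite lee_fin.
Qed.

(** The event lies in [Z > quantile u], of probability [1 - u], for every [u] in []0, 1[]. *)
Lemma negligible_pinfty : P (Z @^-1` [set +oo%E]) = 0.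
Proof.
have mN : measurable (Z @^-1` [set +oo%E]).
  by apply: measurable_funPTI; exact: emeasurable_set1.
have PN : P (Z @^-1` [set +oo%E]) \is a fin_num by exact: fin_num_measure.
have H u : 0 < u < 1 -> fine (P (Z @^-1` [set +oo%E])) <= 1 - u.
  move=> u01; have mE := measurable_funPTI Z (measurable_le (quantile u)).
  rewrite -lee_fin fineK//.
  have Fu := stay_limit_quantile distribution_function_nd distribution_function_ge0 cvg_F u01.
  rewrite -[u in leRHS]Fu EFinB distribution_functionE -probability_setC//.
  apply: le_measure; rewrite ?inE//; first exact: measurableC.
  by move=> w /= ->; rewrite leye_eq.
apply/eqP; rewrite eq_le measure_ge0 andbT leNgt; apply/negP => P0.
have p0 : 0 < fine (P (Z @^-1` [set +oo%E])) by rewrite -lte_fin fineK.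
have p1 : fine (P (Z @^-1` [set +oo%E])) <= 1.
  by rewrite -lee_fin fineK// probability_le1.
(* With [p] the supposed positive mass, [u = 1 - p / 2] would give [p <= p / 2]. *)
have := H (1 - fine (P (Z @^-1` [set +oo%E])) / 2).
lra.
Qed.

(** Used to exchange [Z] for the real variable [fine (Z w)]: the events can differ only where [Z] is
    [+oo], a null event. *)
Lemma law_eq_finite A B : measurable A -> measurable B ->
  (forall w, Z w \is a fin_num -> A w <-> B w) -> P A = P B.
Proof.
move=> mA mB AB.
have mN : measurable (Z @^-1` [set +oo%E]).
  by apply: measurable_funPTI; exact: emeasurable_set1.
have PD C : measurable C -> P C = P (C `\` Z @^-1` [set +oo%E]).
  move=> mC; rewrite (measureDI P mC mN).
  rewrite [X in (_ + X)%E](_ : _ = 0%E) ?adde0//.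
  apply/eqP; rewrite eq_le measure_ge0 andbT -negligible_pinfty.
  by apply: le_measure; rewrite ?inE//; exact: measurableI.
rewrite (PD _ mA) (PD _ mB); congr (P _).
apply/seteqP; split => w [Cw Zw]; split => //; apply/AB => //.
  by rewrite fin_numE Z_neqNy/=; exact/eqP.
by rewrite fin_numE Z_neqNy/=; exact/eqP.
Qed.

Local Notation f := (quantile_density F).

Let f_ge0 := quantile_density_ge0 distribution_function_nd distribution_function_ge0 cvg_F.
Let mf := measurable_quantile_density distribution_function_nd distribution_function_ge0 cvg_F.
Let int_f := integral_quantile_density distribution_function_nd distribution_function_ge0 cvg_F.

Lemma has_quantile_density : has_density Z f.
Proof.
split => //.
have nu0 : density_measure f set0 = 0%E by exact: integral_set0.
have nu_ge0 A : (0 <= density_measure f A)%E.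
  by apply: integral_ge0 => x _; rewrite lee_fin.
pose nu : {measure set (measurableTypeR R) -> \bar R} := HB.pack_for
  {measure set (measurableTypeR R) -> \bar R} (density_measure f)
  (isMeasure.Build _ _ _ (density_measure f) nu0 nu_ge0
     (density_measure_sigma_additive mf f_ge0)).
(* [fine] sends [+oo] to [0]; this happens on a null event only. *)
pose Y (w : T) : measurableTypeR R := fine (Z w).
have mY : measurable_fun setT Y.
  by apply: (measurableT_comp (fine_measurable measurableT)); exact: measurable_funPT.
pose Y' := HB.pack_for {RV P >-> measurableTypeR R} Y
  (isMeasurableFun.Build _ _ T (measurableTypeR R) _ mY).
have YE w : Z w \is a fin_num -> Z w = (Y w)%:E by move=> ?; rewrite fineK.
have law_oy a : distribution P Y' `]a, +oo[%classic = (1 - F a)%:E.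
  rewrite EFinB distribution_functionE -probability_setC; last first.
    exact: (measurable_funPTI _ (measurable_le a)).
  apply: law_eq_finite.
  - by apply: measurable_funPTI; exact: measurable_itv.
  - by apply: measurableC; exact: (measurable_funPTI _ (measurable_le a)).
  - move=> w /YE Yw; rewrite /preimage/= in_itv/= andbT Yw lee_fin ltNge.
    by split=> [/negP//|/negP].
have nu_oy a : 1 < a -> nu `]a, +oo[%classic = (1 - F a)%:E by exact: int_f.
have law_nu a : distribution P Y' `]a, +oo[%classic = nu `]a, +oo[%classic.
  have [a1|a1] := ltP 1 a; first by rewrite law_oy nu_oy.
  (* For [a <= 1] neither measure charges []a, 1]], as [F a = F 1 = 0] and the density is zero
     there, so only the ray from [1] remains. *)
  have Fa0 : F a = 0.
    apply/eqP; rewrite eq_le distribution_function_ge0 andbT.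
    rewrite -(stay_limit1 distribution_function_nd distribution_function_ge0 cvg_F).
    exact: distribution_function_nd.
  have F10 := stay_limit1 distribution_function_nd distribution_function_ge0 cvg_F.
  have -> : nu `]a, +oo[%classic = nu `]1, +oo[%classic.
    rewrite [LHS]integral_mkcond [RHS]integral_mkcond; apply: eq_integral => x _.
    rewrite !patchE !mem_setE !in_itv/= !andbT.
    have [x1|x1] := ltP 1 x; first by rewrite (le_lt_trans a1 x1).
    by rewrite quantile_density_eq0//; case: ifP.
  (* [f] jumps at [1], so FTC is not applied there; [`]1, +oo[] is exhausted instead. *)
  rewrite law_oy Fa0 -F10 -law_oy.
  pose E n := `](1 + n.+1%:R^-1)%R, +oo[%classic : set (measurableTypeR R).
  have EU : \bigcup_n E n = `]1%R, +oo[%classic.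
    apply/seteqP; split => x.
      move=> [n _]; rewrite /E/= !in_itv/= !andbT; apply: lt_trans.
      by rewrite ltrDl invr_gt0.
    rewrite /= in_itv/= andbT => x1; have [n xn] := ltr_add_invr x1.
    by exists n => //; rewrite /E/= in_itv/= andbT.
  have mE n : measurable (E n) by exact: measurable_itv.
  have ndE : nondecreasing_seq E.
    move=> m n mn; apply/subsetPset => x; rewrite /E/= !in_itv/= !andbT.
    by apply: le_lt_trans; rewrite lerD2l lef_pV2 ?posrE// ler_nat ltnS.
  have mUE : measurable (\bigcup_n E n) by exact: bigcup_measurable.
  have c1 := nondecreasing_cvg_mu (mu := distribution P Y') mE mUE ndE.
  have c2 := nondecreasing_cvg_mu (mu := nu) mE mUE ndE.
  rewrite -EU; apply: (cvg_unique _ c1) => //.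
  rewrite (_ : _ \o E = nu \o E)//; apply/funext => n.
  by rewrite [LHS]law_oy [RHS]nu_oy// ltrDl invr_gt0.
move=> B mB; rewrite -[RHS]/(nu (EFin @^-1` B)).
have mEB : measurable (EFin @^-1` B : set (measurableTypeR R)).
  by rewrite -[X in measurable X]setTI; exact: EFin_measurable.
rewrite -(measure_unique_itvoy law_nu)//.
apply: law_eq_finite.
- exact: measurable_funPTI.
- exact: (measurable_funPTI Y').
- by move=> w /YE Yw; rewrite /preimage/= Yw.
Qed.

End law_of_limit.

Theorem theorem1 (R : realType) (d : measure_display) (T : measurableType d)
    (P : probability T R) (X : nat -> {RV P >-> R})
    (X_indep : mutually_independent X)
    (X_exp : forall n, exponential_with_mean 1 (X n)) :
  let Z : {RV P >-> \bar R} := sup_running_mean X in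
  let F : R -> R := distribution_function Z in
  {ae P, forall w, Z w \is a fin_num} /\
  ((forall x : R, 0 < x ->
      let a (k : nat) : R :=
        (k ^ k.-1)%N%:R / (k`!)%:R * x ^+ k.-1 * expR (- (k%:R * x)) in
      cvgn (fun n : nat => \sum_(1 <= k < n) a k) /\
      F x = 1 - limn (fun n : nat => \sum_(1 <= k < n) a k)) /\
   (exists f : R -> R,
      [/\ has_density Z f,
          forall x : R, x != 1 -> {for x, continuous f},
          forall x : R, 1 < x -> 0 < f x &
          forall x : R, x < 1 -> f x = 0])) /\
  (set_bij `]1, +oo[ `]0, 1[ F /\
   (forall u : R, 0 < u < 1 ->
      'pinv_(fun=> 0) `]1, +oo[ F u = - ln (1 - u) / u)).
Proof.
move=> Z F.
have Z_neqNy w : Z w != -oo%E.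
  rewrite -ltNye; apply: (@lt_le_trans _ _ (running_mean X 0 w)%:E).
    exact: ltNyr.
  by apply: ereal_sup_ubound; exists 0%N.
have cvg_F x : 0 < x -> stay x n x @[n --> \oo] --> F x.
  by move=> x0; exact: cvg_stay_distribution.
have F_nd : {homo F : x y / x <= y} by exact: distribution_function_nd.
have F_ge0 x : 0 <= F x by exact: distribution_function_ge0.
split; last split; [|split|split].
- exists (Z @^-1` [set +oo%E]); split.
  + by apply: measurable_funPTI; exact: emeasurable_set1.
  + exact: negligible_pinfty.
  + by move=> w /= /negP; rewrite fin_numE Z_neqNy/= negbK => /eqP.
- move=> x x0 a; have := stay_limit_series cvg_F x0.
  rewrite -/a => cvg_a; split; first by apply/cvg_ex; exists (1 - F x).
  by rewrite (cvg_lim _ cvg_a)// subKr.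
- exists (quantile_density F); split.
  + exact: has_quantile_density.
  + exact: continuous_quantile_density.
  + exact: quantile_density_gt0.
  + by move=> x /ltW; exact: quantile_density_eq0.
- exact: stay_limit_bij.
- exact: stay_limit_pinv.
Qed.
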